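(* There is an absolute constant $C>0$ such that for every $\kappa \in (0,1)$ and every integer $n \geq 2$ there exists a $\kappa$-template-graph on the vertex set $[n]$ with at most $C\, n^{4/3}\log n/\kappa$ edges (i.e. with $O(n^{4/3}\log n/\kappa)$ edges).
   Context: Let $\kappa\in(0,1)$. An undirected graph $G$ on vertex set $[n]=\{1,\dots,n\}$ is a $\kappa$-template-graph if for every pair of disjoint sets $H_1,H_2\subseteq[n]$, both of size at least $\kappa n^{2/3}$, there is at least one edge of $G$ with one endpoint in $H_1$ and the other in $H_2$. *)

(* Defs.v *)
From mathcomp Require Import all_boot all_order all_algebra.
From mathcomp Require Import reals exp.

Set Implicit Arguments.
Unset Strict Implicit.
Unset Printing Implicit Defensive.

Import Order.TTheory GRing.Theory Num.Theory.
Local Open Scope ring_scope.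

Definition simple_graph (T : finType) (e : rel T) : Prop :=
  symmetric e /\ irreflexive e.

(* Edges are unordered pairs, so x -- y and y -- x are counted once. *)
Definition edge_set (T : finType) (e : rel T) : {set {set T}} :=
  [set [set x; y] | x in T, y in T & e x y].

(* The vertex set [n] is 'I_n.  The threshold kappa * n^(2/3) is a real number
   and is not rounded. *)
Definition template_graph (R : realType) (kappa : R) (n : nat)
    (e : rel 'I_n) : Prop :=
  simple_graph e /\
  forall H1 H2 : {set 'I_n},
    [disjoint H1 & H2] ->
    kappa * n%:R `^ (2 / 3) <= #|H1|%:R ->
    kappa * n%:R `^ (2 / 3) <= #|H2|%:R ->
    exists x y : 'I_n, [/\ x \in H1, y \in H2 & e x y].

(* Main.v *)
Require Import Defs.
From mathcomp Require Import all_boot all_order all_algebra.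
From mathcomp Require Import ring lra.
From mathcomp Require Import reals sequences exp.

(** With [s = kappa * n^(2/3)] and [m] the ceiling of [s], it suffices that the
    edges meet [A * B] for all [m]-subsets [A] and [B].  Draw
    [N = O(n^2 ln n / m)] vertex pairs uniformly with replacement: a fixed
    [A * B] is missed with probability [(1 - m^2/n^2)^N < n^(-2m)], and there
    are at most [n^(2m)] pairs [(A, B)], so some draw meets them all. *)

Set Implicit Arguments.
Unset Strict Implicit.
Unset Printing Implicit Defensive.

Import Order.TTheory GRing.Theory Num.Theory.
Local Open Scope ring_scope.

Lemma leq_card_bigcup (I T : finType) (P : pred I) (F : I -> {set T}) :
  (#|\bigcup_(i | P i) F i| <= \sum_(i | P i) #|F i|)%N.
Proof.
elim/big_rec2: _ => [|i n A _ leAn]; first by rewrite cards0.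
by rewrite (leq_trans (leq_card_setU _ _)) // leq_add2l.
Qed.

(** Union bound by counting: at most [(#|T| - k) ^ N] of the [#|T| ^ N] sequences of length [N] miss
    a given member of [F], so some sequence misses none, and its image serves as [S]. *)
Lemma hitting_set (T : finType) (F : {set {set T}}) (k N : nat) :
  (forall A, A \in F -> (k <= #|A|)%N) ->
  (#|F| * (#|T| - k) ^ N < #|T| ^ N)%N ->
  exists S : {set T}, (#|S| <= N)%N /\
    forall A, A \in F -> exists2 x, x \in A & x \in S.
Proof.
move=> geFk ltF.
pose avoid (A : {set T}) : {set {ffun 'I_N -> T}} :=
  [set f : {ffun 'I_N -> T} in ffun_on (mem (~: A))].
have [f nf] : exists f, f \notin \bigcup_(A in F) avoid A.
  apply/existsP; rewrite -negb_forall; apply/negP => /forallP allf.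
  move: ltF; rewrite ltnNge => /negP; apply.
  have -> : (#|T| ^ N = #|\bigcup_(A in F) avoid A|)%N.
    rewrite (_ : \bigcup_(A in F) avoid A = setT).
      by rewrite cardsT card_ffun card_ord.
    by apply/setP => f; rewrite inE allf.
  apply: (leq_trans (leq_card_bigcup _ _)).
  rewrite -sum_nat_const; apply: leq_sum => A AF.
  rewrite cardsE card_ffun_on card_ord.
  (* [leq_exp2r] needs a positive exponent; for [N = 0] both sides are 1. *)
  by case: (N) => [|N'] //; rewrite leq_exp2r // cardsCs setCK leq_sub2l // geFk.
exists [set f i | i : 'I_N]; split.
  by rewrite (leq_trans (leq_imset_card _ _)) // card_ord.
move=> A AF; move/bigcupP: nf => nf.
have : f \notin avoid A by apply/negP => fA; apply: nf; exists A.
rewrite inE => /ffun_onP fA.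
have [/existsP[i fiA]|] := boolP [exists i, f i \in A].
  by exists (f i) => //; apply: imset_f.
rewrite negb_exists => /forallP nA; case: fA => i.
by rewrite inE nA.
Qed.

Lemma leq_ffact_exp (n m : nat) : (n ^_ m <= n ^ m)%N.
Proof.
elim: m => // m IHm; rewrite ffactnSr expnSr.
by rewrite leq_mul // leq_subr.
Qed.

Lemma leq_bin_exp (n m : nat) : ('C(n, m) <= n ^ m)%N.
Proof.
apply: leq_trans (leq_ffact_exp n m).
by rewrite -bin_ffact leq_pmulr // fact_gt0.
Qed.

Lemma subset_of_card (T : finType) (A : {set T}) (m : nat) :
  (m <= #|A|)%N -> exists2 B : {set T}, B \subset A & #|B| = m.
Proof.
rewrite -bin_gt0 -cards_draws card_gt0 => /set0Pn[B].
by rewrite inE => /andP[sBA /eqP cB]; exists B.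
Qed.

(** The family to hit consists of the products of two [m]-subsets: each has [m ^ 2] points, and
    there are at most ['C(n, m) ^ 2] of them. Larger sets are first shrunk to [m]-subsets. *)
Lemma product_hitting_set (n m N : nat) :
  (n ^ (2 * m) * (n ^ 2 - m ^ 2) ^ N < (n ^ 2) ^ N)%N ->
  exists S : {set 'I_n * 'I_n}, (#|S| <= N)%N /\
    forall A B : {set 'I_n}, (m <= #|A|)%N -> (m <= #|B|)%N ->
      exists x y, [/\ x \in A, y \in B & (x, y) \in S].
Proof.
move=> ltN; pose D := [set A : {set 'I_n} | #|A| == m].
pose F := [set setX p.1 p.2 | p in setX D D].
have geF A : A \in F -> (m ^ 2 <= #|A|)%N.
  case/imsetP => -[B C] /setXP[]; rewrite !inE => /eqP cB /eqP cC ->.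
  by rewrite cardsX cB cC.
have leF : (#|F| <= n ^ (2 * m))%N.
  rewrite (leq_trans (leq_imset_card _ _)) // cardsX card_draws card_ord.
  by rewrite mul2n -addnn expnD leq_mul // leq_bin_exp.
have [|S [leS hitS]] := @hitting_set _ F (m ^ 2) N geF.
  rewrite card_prod card_ord mulnn.
  by apply: leq_ltn_trans ltN; rewrite leq_mul2r leF orbT.
exists S; split => // A B /subset_of_card[A' sA cA] /subset_of_card[B' sB cB].
have [|[x y] /setXP[xA yB] xyS] := hitS (setX A' B').
  by apply/imsetP; exists (A', B') => //; rewrite !inE cA cB eqxx.
by exists x, y; split => //; [apply: (subsetP sA) | apply: (subsetP sB)].
Qed.

(** With [t = m^2 / n^2], the bound [1 - t <= expR (- t)] reduces the claim to
    [2 * m * ln n < N * t], which is the logarithmic hypothesis multiplied by [m / n^2]. *)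
Lemma union_bound_lt (R : realType) (n m N : nat) :
  (0 < n)%N -> (m <= n)%N -> 2 * n%:R ^+ 2 * ln n%:R < m%:R * N%:R :> R ->
  (0 < m)%N -> (n ^ (2 * m) * (n ^ 2 - m ^ 2) ^ N < (n ^ 2) ^ N)%N.
Proof.
move=> n0 lemn ltN m0.
have n0R : 0 < n%:R :> R by rewrite ltr0n.
have m0R : 0 < m%:R :> R by rewrite ltr0n.
rewrite -(ltr_nat R) natrM !natrX natrB ?leq_sqr // !natrX.
pose t : R := m%:R ^+ 2 / n%:R ^+ 2.
have -> : n%:R ^+ 2 - m%:R ^+ 2 = n%:R ^+ 2 * (1 - t) :> R.
  by rewrite /t; field; rewrite lt0r_neq0.
have le1t : 0 <= 1 - t.
  rewrite subr_ge0 /t ler_pdivrMr ?exprn_gt0 // mul1r.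
  by rewrite lerXn2r ?nnegrE ?ler0n // ler_nat.
rewrite exprMn mulrCA -[ltRHS]mulr1 ltr_pM2l ?exprn_gt0 //.
have leE : (1 - t) ^+ N <= expR (- t *+ N).
  rewrite -mulr_natl expRM_natl lerXn2r ?nnegrE ?expR_ge0 //.
  exact: expR_ge1Dx.
have -> : n%:R ^+ (2 * m) = expR (ln n%:R *+ (2 * m)) :> R.
  by rewrite -lnXn // lnK // posrE exprn_gt0.
apply: le_lt_trans (ler_wpM2l (expR_ge0 _) leE) _.
rewrite -expRD expR_lt1 mulNrn subr_lt0.
rewrite -[ltLHS]mulr_natl -[ltRHS]mulr_natl natrM.
rewrite /t mulrA ltr_pdivlMr ?exprn_gt0 //.
have -> : 2 * m%:R * ln n%:R * n%:R ^+ 2 =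
  m%:R * (2 * n%:R ^+ 2 * ln n%:R) :> R by ring.
have -> : N%:R * m%:R ^+ 2 = m%:R * (m%:R * N%:R) :> R by ring.
by rewrite ltr_pM2l.
Qed.

(** The drawn pairs are ordered and may lie on the diagonal, hence the symmetrization and the
    removal of loops. *)
Definition graph_of (T : finType) (S : {set T * T}) : rel T :=
  fun x y => (x != y) && (((x, y) \in S) || ((y, x) \in S)).

Lemma graph_of_simple (T : finType) (S : {set T * T}) :
  simple_graph (graph_of S).
Proof.
by split=> [x y|x]; rewrite /graph_of ?eqxx // eq_sym orbC.
Qed.

Lemma card_edge_set_graph_of (T : finType) (S : {set T * T}) :
  (#|edge_set (graph_of S)| <= #|S|)%N.
Proof.
apply: leq_trans (leq_imset_card (fun p : T * T => [set p.1; p.2]) (mem S)).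
apply/subset_leq_card/subsetP => e /imset2P[x y _].
rewrite inE => /andP[_ /andP[_ /orP[xyS|xyS]]] ->; apply/imsetP.
  by exists (x, y).
by exists (y, x) => //=; rewrite setUC.
Qed.

(** From [ln (1 + x) <= x] at [x = 1/n - 1] one gets [ln n >= 1 - 1/n]. *)
Lemma ln_nat_ge_half (R : realType) (n : nat) :
  (2 <= n)%N -> 1 / 2 <= ln n%:R :> R.
Proof.
move=> n2; have n0R : 0 < n%:R :> R by rewrite ltr0n (leq_trans _ n2).
have : ln (n%:R^-1) <= n%:R^-1 - 1 :> R.
  have := @le_ln1Dx R (n%:R^-1 - 1); rewrite [1 + _]addrC subrK; apply.
  by rewrite ltrBDr addNr invr_gt0.
have : n%:R^-1 <= 2^-1 :> R by rewrite lef_pV2 ?posrE // ler_nat.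
by rewrite lnV ?posrE //; lra.
Qed.

Theorem theorem6 (R : realType) :
  exists C : R, 0 < C /\
    forall (kappa : R) (n : nat),
      0 < kappa < 1 -> (2 <= n)%N ->
      exists G : rel 'I_n,
        template_graph kappa G /\
        #|edge_set G|%:R <= C * n%:R `^ (4 / 3) * ln n%:R / kappa.
Proof.
(* The edge count is at most [X + 1], and both [X] and 1 are at most [2 * n^2 * L / s]; this gives
   4. *)
exists 4; split => // kappa n /andP[k0 k1] n2.
have n0 : (0 < n)%N by apply: leq_trans n2.
have n0R : 0 < n%:R :> R by rewrite ltr0n.
have n1R : 1 <= n%:R :> R by rewrite ler1n.
set p : R := n%:R `^ (2 / 3); pose s := kappa * p.
have p0 : 0 < p by apply: powR_gt0.
have lepn : p <= n%:R by rewrite ler1_powR //; lra.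
have s0 : 0 < s by rewrite mulr_gt0.
have lesn : s <= n%:R by rewrite /s; nra.
pose L : R := ln n%:R.
have L2 : 1 / 2 <= L by apply: ln_nat_ge_half.
(* [m] is the ceiling of [s]; minimality turns the real threshold on [H1] and [H2] into [m <= #|H1|]
   and [m <= #|H2|]. *)
have [m [lesm minm]] :
    exists m : nat, s <= m%:R /\ forall k : nat, s <= k%:R -> (m <= k)%N.
  have exm : exists k : nat, s <= k%:R by exists n.
  by case: (ex_minnP exm) => m ? ?; exists m.
have lemn : (m <= n)%N by apply: minm.
have m0 : (0 < m)%N by rewrite -(ltr_nat R) (lt_le_trans s0).
have m0R : 0 < m%:R :> R by rewrite ltr0n.
pose X := 2 * n%:R ^+ 2 * L / m%:R.
(* The successor makes [X < N] strict, as the union bound requires, while keeping [N <= X + 1]. *)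
pose N := (Num.truncn X).+1.
have X0 : 0 <= X by rewrite /X !mulr_ge0 ?invr_ge0 ?exprn_ge0 //; lra.
have ltXN : 2 * n%:R ^+ 2 * L < m%:R * N%:R.
  by rewrite [ltRHS]mulrC -ltr_pdivrMr // truncnS_gt.
have [S [leSN hitS]] :=
  product_hitting_set (union_bound_lt n0 lemn ltXN m0).
exists (graph_of S); split.
  split; first exact: graph_of_simple.
  move=> H1 H2 dH /minm mH1 /minm mH2.
  have [x [y [xH yH xyS]]] := hitS H1 H2 mH1 mH2.
  exists x, y; split => //; rewrite /graph_of xyS andbT.
  (* Disjointness of [H1] and [H2] gives [x != y], so the pair survives the removal of loops. *)
  by apply: contraTneq yH => <-; rewrite (disjointFr dH).
have -> : n%:R `^ (4 / 3) = n%:R ^+ 2 / p :> R.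
  rewrite -powR_mulrn ?ler0n // /p -powRB; last by rewrite lt0r_neq0 // implybT.
  by congr (_ `^ _); lra.
have -> : 4 * (n%:R ^+ 2 / p) * ln n%:R / kappa = 4 * n%:R ^+ 2 * L / s.
  by rewrite /s /L; field; rewrite !lt0r_neq0.
have leX : X <= 2 * n%:R ^+ 2 * L / s.
  rewrite /X ler_pM2l ?lef_pV2 ?posrE // !mulr_gt0 ?exprn_gt0 //; lra.
have leN : N%:R <= X + 1 by rewrite /N -natr1 lerD2r truncn_le.
(* The rounding term is absorbed: [s <= n <= n^2 <= 2 * n^2 * L], the last step by [L >= 1/2]. *)
have le1 : 1 <= 2 * n%:R ^+ 2 * L / s.
  rewrite ler_pdivlMr // mul1r (le_trans lesn) //; nra.
apply: (@le_trans _ _ (X + 1)).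
  apply: le_trans leN; rewrite ler_nat.
  exact: leq_trans (card_edge_set_graph_of S) leSN.
have -> : 4 * n%:R ^+ 2 * L / s =
  2 * n%:R ^+ 2 * L / s + 2 * n%:R ^+ 2 * L / s by field; rewrite lt0r_neq0.
exact: lerD.
Qed.
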